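(* Let $p=(p_1,p_2)$ and $q=(q_1,q_2)$ be two pairs of projection matrices, all of the same size. Then $p$ and $q$ are unitarily equivalent if and only if $Q_p=Q_q$ (equality of polynomials in $(z_0,z_1,z_2)$).
   Context: All matrices are complex square matrices of the same size $k\times k$. A projection is a matrix $p$ with $p^*=p$ and $p^2=p$. For a tuple $A=(A_1,\dots,A_n)$ of $k\times k$ matrices, the characteristic polynomial is $Q_A(z)=\det(z_0I+z_1A_1+\cdots+z_nA_n)$, $z=(z_0,\dots,z_n)\in\mathbb{C}^{n+1}$. Two tuples $(A_1,\dots,A_n)$ and $(B_1,\dots,B_n)$ are unitarily equivalent if there is a unitary matrix $U$ with $UA_i=B_iU$ for all $i$. *)

(* Defs.v *)
From HB Require Import structures.
From mathcomp Require Import all_boot all_order all_algebra.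
From mathcomp Require Import reals.
From mathcomp Require Import complex mpoly.

Set Implicit Arguments.
Unset Strict Implicit.
Unset Printing Implicit Defensive.

Import GRing.Theory Num.Theory.
Local Open Scope ring_scope.
Local Open Scope complex_scope.
Local Open Scope sesquilinear_scope.

Definition is_projection (R : realType) (k : nat) (P : 'M[R[i]]_k) : Prop :=
  P ^t* = P /\ P *m P = P.

(* det(z_0 I + z_1 A_1 + ... + z_n A_n) as a formal polynomial: the variable
   z_0 is 'X_ord0, and z_(i+1), which is 'X_(lift ord0 i), goes with the matrix
   A i, the tuple being indexed from 0. *)
Definition Qpoly (R : realType) (n k : nat) (A : 'I_n -> 'M[R[i]]_k) :
    {mpoly R[i][n.+1]} :=
  \det ('X_ord0 *: 1%:M +
        \sum_(i < n) 'X_(lift ord0 i) *: map_mx (@mpolyC n.+1 R[i]) (A i)).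

Definition unitarily_equivalent (R : realType) (n k : nat)
    (A B : 'I_n -> 'M[R[i]]_k) : Prop :=
  exists2 U : 'M[R[i]]_k, U \is unitarymx & forall i, U *m A i = B i *m U.

(* Main.v *)
(** Only the characteristic polynomial of A = p_1 + 2 p_2 is needed.  For both
    pairs A is Hermitian, so after a unitary change of basis the two matrices A
    are the same real diagonal matrix diag(d).  Eliminating p_2 from p_2^2 = p_2
    gives (d_i + d_j - 3) (p_1)_ij = (d_i^2 - 2 d_i) delta_ij, hence the diagonal
    of p_1 is a function of d, and its off-diagonal part N only couples d_i with
    3 - d_i and has a square that is again a function of d.  If M is the
    off-diagonal part of q_1, then the matrix that is 1 on the eigenvalues below
    3/2 and on the common kernel of N and M, and M N / N^2 elsewhere, is unitary,
    commutes with diag(d) and carries N to M. *)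

Require Import Defs.
From mathcomp Require Import all_boot all_order all_fingroup all_algebra.
From mathcomp Require Import ring.
From mathcomp Require Import reals.
From mathcomp Require Import complex mpoly.

Set Implicit Arguments.
Unset Strict Implicit.
Unset Printing Implicit Defensive.

Import Order.TTheory GRing.Theory Num.Theory.
Local Open Scope ring_scope.
Local Open Scope complex_scope.
Local Open Scope sesquilinear_scope.

(** * Functional calculus of a diagonal matrix and the flip of t and 3 - t *)

Section DiagonalPencil.
Variables (C : numClosedFieldType) (k : nat) (d : 'rV[C]_k).

Definition dfun (f : C -> C) : 'M[C]_k := diag_mx (\row_i f (d 0 i)).

(** Entrywise form of N D = (3 - D) N with D = [diag_mx d]: N sends the t-eigenspace of D into the
    (3 - t)-eigenspace. *)
Definition flips (N : 'M[C]_k) := forall i j, N i j != 0 -> d 0 i + d 0 j = 3.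

Lemma dfun_mul f g : dfun f *m dfun g = dfun (fun t => f t * g t).
Proof.
by rewrite /dfun mulmx_diag; congr diag_mx; apply/rowP=> i; rewrite !mxE. Qed.

Lemma dfun_add f g : dfun f + dfun g = dfun (fun t => f t + g t).
Proof.
by rewrite /dfun -raddfD; congr diag_mx; apply/rowP=> i; rewrite !mxE. Qed.

Lemma eq_dfun f g : (forall i, f (d 0 i) = g (d 0 i)) -> dfun f = dfun g.
Proof. by move=> fg; congr diag_mx; apply/rowP=> i; rewrite !mxE. Qed.

Lemma dfun_adj f : (forall i, f (d 0 i) \is Num.real) -> (dfun f)^t* = dfun f.
Proof.
move=> fr; rewrite /dfun tr_diag_mx map_diag_mx; congr diag_mx.
by apply/rowP=> i; rewrite !mxE; apply/CrealP.
Qed.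

Lemma flips_dfun N f : flips N ->
  N *m dfun f = dfun (fun t => f (3 - t)) *m N.
Proof.
move=> fN; rewrite /dfun mul_mx_diag mul_diag_mx.
apply/matrixP=> i j; rewrite !mxE.
have [->|/fN e] := eqVneq (N i j) 0; first by rewrite mul0r mulr0.
by rewrite mulrC; congr (f _ * _); rewrite -e; ring.
Qed.

Lemma flips_mul (M1 M2 : 'M[C]_k) i j : flips M1 -> flips M2 ->
  (M1 *m M2) i j != 0 -> d 0 i = d 0 j.
Proof.
move=> f1 f2; have [//|ne] := eqVneq (d 0 i) (d 0 j).
case/eqP; rewrite mxE big1 // => l _.
have [->|/f1 e1] := eqVneq (M1 i l) 0; first by rewrite mul0r.
have [->|/f2 e2] := eqVneq (M2 l j) 0; first by rewrite mulr0.
case/eqP: ne; apply: (addIr (d 0 l)); rewrite e1 -e2; ring.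
Qed.

(* [t] and [3 - t] are the eigenvalues of p_1 + 2 p_2 in a 2x2 block; in an
   eigenbasis there the diagonal of p_1 is [diagq t], [diagq (3 - t)], and
   [offdiagq t] is the squared modulus of the off-diagonal entry. *)
Definition diagq (t : C) := t * (2 - t) / (3 - 2 * t).
Definition offdiagq (t : C) :=
  t * (1 - t) * (2 - t) * (3 - t) / (3 - 2 * t) ^+ 2.

Lemma offdiagq_flip t : offdiagq (3 - t) = offdiagq t.
Proof.
rewrite /offdiagq; have -> : (3 - 2 * (3 - t)) ^+ 2 = (3 - 2 * t) ^+ 2 by ring.
by congr (_ / _); ring.
Qed.

(** In a 2x2 block this is a diagonal entry of p_1^2 = p_1. *)
Lemma diagq_offdiagq t : 3 - 2 * t != 0 -> diagq t - diagq t ^+ 2 = offdiagq t.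
Proof. by move=> h; rewrite /diagq /offdiagq; field. Qed.

Lemma diagq_real t : t \is Num.real -> diagq t \is Num.real.
Proof. by move=> tr; rewrite /diagq !(rpredM, rpredV, rpredB, rpred_nat). Qed.

Lemma offdiagq_real t : t \is Num.real -> offdiagq t \is Num.real.
Proof.
move=> tr; rewrite /offdiagq.
by rewrite !(rpredM, rpredV, rpredX, rpredB, rpred_nat, rpred1).
Qed.

(** * Shape of a projection pair with diagonal pencil *)

Section Structure.
Variables (P1 P2 : 'M[C]_k).
Hypotheses (P1h : P1^t* = P1) (P1i : P1 *m P1 = P1) (P2i : P2 *m P2 = P2).
Hypothesis P12 : P1 + P2 *+ 2 = diag_mx d.
Hypothesis d_real : forall i, d 0 i \is Num.real.

Lemma pencil_entries i j :
  (d 0 i + d 0 j - 3) * P1 i j = (d 0 i ^+ 2 - 2 * d 0 i) * (i == j)%:R.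
Proof.
(* The matrix [diag_mx d - P1] is 2 P2, and (2 P2)^2 = 4 P2. *)
have e : (diag_mx d - P1) *m (diag_mx d - P1) = (diag_mx d - P1) *+ 2.
  rewrite -P12 addrAC subrr add0r mulr2n mulmxDl !mulmxDr !P2i -mulr2n.
  by rewrite -mulr2n.
rewrite mulmxBl !mulmxBr P1i mul_diag_mx mul_mx_diag mul_diag_mx in e.
move/matrixP: e => /(_ i j); rewrite !mxE.
move/eqP; rewrite -subr_eq0 => /eqP e; apply/eqP; rewrite -subr_eq0 -oppr_eq0.
apply/eqP; rewrite -{}[RHS]e.
case: (eqVneq i j) => [->|_]; rewrite ?mulr1n ?mulr0n ?mulr1 ?mulr0.
  by move: (P1 j j) (d 0 j) => x t; ring.
by move: (P1 i j) (d 0 i) (d 0 j) => x s t; ring.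
Qed.

(** At d_i = 3/2 the diagonal case of [pencil_entries] would read 0 = -3/4. This keeps the
    denominators of [diagq] and [offdiagq] nonzero. *)
Lemma spectrum_neq i : 3 - 2 * d 0 i != 0.
Proof.
apply/eqP => e; have := pencil_entries i i; rewrite eqxx mulr1.
have -> : d 0 i = 3 / 2 by rewrite -[3 in RHS](subrK (2 * d 0 i)) e; field.
move=> /eqP; rewrite -subr_eq0.
have -> : (3 / 2 + 3 / 2 - 3) * P1 i i - ((3 / 2) ^+ 2 - 2 * (3 / 2))
    = 3 / 4 :> C by field.
by rewrite mulf_eq0 invr_eq0 !pnatr_eq0.
Qed.

Let N := P1 - dfun diagq.

Lemma pencil_diag0 i : N i i = 0.
Proof.
rewrite !mxE eqxx mulr1n; have := pencil_entries i i; rewrite eqxx mulr1 => e.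
have h := spectrum_neq i.
apply: (mulfI h); rewrite mulr0 mulrBr /diagq.
have -> : (3 - 2 * d 0 i) * P1 i i = - ((d 0 i + d 0 i - 3) * P1 i i) by ring.
by rewrite e; field.
Qed.

Lemma pencil_flips : flips N.
Proof.
move=> i j; have [->|ij] := eqVneq i j; first by rewrite pencil_diag0 eqxx.
rewrite !mxE (negPf ij) mulr0n subr0 => h.
have /eqP := pencil_entries i j.
rewrite (negPf ij) mulr0 mulf_eq0 (negPf h) orbF.
by rewrite subr_eq0 => /eqP.
Qed.

Lemma pencil_adj : N^t* = N.
Proof.
rewrite linearB map_mxB P1h dfun_adj // => i; exact/diagq_real/d_real.
Qed.

(** Two flips return to the same eigenvalue, so only entries with d_i = d_j can survive. There N
    vanishes and P1 reduces to its diagonal, so expanding the square leaves [diagq] minus its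
    square. *)
Lemma pencil_sqr : N *m N = dfun offdiagq.
Proof.
have e : N *m N =
    P1 - P1 *m dfun diagq - (dfun diagq *m P1 - dfun diagq *m dfun diagq).
  by rewrite mulmxBl !mulmxBr P1i.
apply/matrixP => i j; have [dij|ne] := eqVneq (d 0 i) (d 0 j); last first.
  have ij : i != j by apply: contraNneq ne => ->.
  rewrite [RHS]mxE (negPf ij) mulr0n; apply/eqP; apply: contraNT ne.
  by move=> /(flips_mul pencil_flips pencil_flips) ->.
(* A flip between equal eigenvalues would force 2 d_i = 3. *)
have Nij : N i j = 0.
  apply: contraNeq (spectrum_neq i) => /pencil_flips; rewrite -dij => <-.
  by apply/eqP; ring.
have P1ij : P1 i j = diagq (d 0 i) *+ (i == j).
  by move: Nij; rewrite !mxE => /eqP; rewrite subr_eq0 => /eqP.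
rewrite e dfun_mul /dfun mul_mx_diag mul_diag_mx !mxE P1ij -dij.
rewrite -(diagq_offdiagq (spectrum_neq i)).
by case: (i == j); rewrite ?mulr1n ?mulr0n; ring.
Qed.
End Structure.

(** * A unitary carrying one off-diagonal part to the other *)

Section Intertwiner.
Variables N M : 'M[C]_k.
Hypotheses (Nh : N^t* = N) (Mh : M^t* = M) (fN : flips N) (fM : flips M).
Hypotheses (N2 : N *m N = dfun offdiagq) (M2 : M *m M = dfun offdiagq).
Hypothesis d_real : forall i, d 0 i \is Num.real.
Hypothesis d_neq : forall i, 3 - 2 * d 0 i != 0.

(** For Hermitian X the (j, j) entry of X^2 is the sum of the |X_lj|^2, so when it is 0 the whole
    column j vanishes. *)
Lemma offdiagq0_entry (X : 'M[C]_k) i j : X^t* = X -> X *m X = dfun offdiagq ->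
  offdiagq (d 0 j) = 0 -> X i j = 0.
Proof.
move=> Xh X2 h0; have := X2 => /matrixP /(_ j j).
rewrite !mxE eqxx h0 mulr1n => /eqP; rewrite psumr_eq0 => [|l _].
  move=> /allP /(_ i (mem_index_enum _)) /=.
  rewrite -{1}Xh !mxE mulrC -normCK expf_eq0 normr_eq0 /=.
  by move/eqP.
by rewrite -{1}Xh !mxE mulrC -normCK exprn_ge0.
Qed.

(* [U] is [M N / N^2] where [low] fails and [1] where it holds. *)
Let low t := (2 * t < 3) || (offdiagq t == 0).
Let a t : C := (low t)%:R.
Let b t : C := if low t then 0 else (offdiagq t)^-1.
Let U := dfun a + M *m N *m dfun b.

(** The flip is the reflection about 3/2, a value excluded by [d_neq], so exactly one of t and 3 - t
    lies below it. *)
Lemma low_flip i : offdiagq (d 0 i) != 0 -> low (3 - d 0 i) = ~~ low (d 0 i).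
Proof.
move=> h; rewrite /low offdiagq_flip (negPf h) !orbF.
have -> : 2 * (3 - d 0 i) = 3 + (3 - 2 * d 0 i) by ring.
(* The order on [C] is partial, so negating a strict inequality requires both sides to be real. *)
rewrite -subr_gt0 -[RHS]real_leNgt ?rpredM ?realn //.
have -> : 3 - (3 + (3 - 2 * d 0 i)) = 2 * d 0 i - 3 by ring.
rewrite subr_gt0 lt_neqAle; case: eqP => //= e.
by have := d_neq i; rewrite e subrr eqxx.
Qed.

Lemma MN_dfun f : M *m N *m dfun f = dfun f *m (M *m N).
Proof.
rewrite -mulmxA flips_dfun // mulmxA flips_dfun // mulmxA; congr (_ *m _ *m _).
by apply: eq_dfun => i; congr f; ring.
Qed.

Lemma intertwiner_dfun f : U *m dfun f = dfun f *m U.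
Proof.
rewrite mulmxDl mulmxDr !dfun_mul; congr (_ + _).
  by apply: eq_dfun => i; rewrite mulrC.
rewrite -[LHS]mulmxA dfun_mul [RHS]mulmxA -MN_dfun -[RHS]mulmxA dfun_mul.
by congr (_ *m _); apply: eq_dfun => i; rewrite mulrC.
Qed.

Lemma mul_dfun_supp (X : 'M[C]_k) f g : X^t* = X -> X *m X = dfun offdiagq ->
  (forall i, offdiagq (d 0 i) != 0 -> f (d 0 i) = g (d 0 i)) ->
  X *m dfun f = X *m dfun g.
Proof.
move=> Xh X2 fg; rewrite /dfun !mul_mx_diag; apply/matrixP=> i j; rewrite !mxE.
have [h|/fg -> //] := eqVneq (offdiagq (d 0 j)) 0.
by rewrite (offdiagq0_entry _ Xh X2 h) !mul0r.
Qed.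

(** Moving all functions of d to the right turns both sides into N f + M g. The coefficients agree
    where [offdiagq] is nonzero, because the flip exchanges [low] and its negation; elsewhere the
    columns of N and M are zero. *)
Lemma intertwiner_offdiag : U *m N = M *m U.
Proof.
have -> : U *m N =
    N *m dfun (fun t => a (3 - t)) + M *m dfun (fun t => offdiagq t * b (3 - t)).
  rewrite mulmxDl; congr (_ + _).
    rewrite flips_dfun //; congr (_ *m _).
    by apply: eq_dfun => i; congr a; ring.
  rewrite -!mulmxA; congr (_ *m _).
  rewrite -dfun_mul -N2 -!mulmxA; congr (_ *m _).
  rewrite [in RHS]flips_dfun //; congr (_ *m _).
  by apply: eq_dfun => i; congr b; ring.
have -> : M *m U = M *m dfun a + N *m dfun (fun t => offdiagq t * b t).
  rewrite mulmxDr; congr (_ + _); rewrite !mulmxA M2 -dfun_mul mulmxA.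
  rewrite [N *m dfun offdiagq]flips_dfun //; congr (_ *m _ *m _).
  by apply: eq_dfun => i; rewrite offdiagq_flip.
rewrite addrC; congr (_ + _); apply: mul_dfun_supp => // i h.
  rewrite /b /a low_flip // offdiagq_flip.
  by case: (low (d 0 i)); rewrite /= ?mulr0 ?divff.
by rewrite /b /a low_flip //; case: (low (d 0 i)); rewrite /= ?mulr0 ?divff.
Qed.

(** Since M N N M is the square of [offdiagq], the product of U with its adjoint is a^2 + b^2
    [offdiagq]^2, which is 1 in both cases of [low]. *)
Lemma intertwiner_unitary : U \is unitarymx.
Proof.
have ar i : a (d 0 i) \is Num.real by apply: realn.
have br i : b (d 0 i) \is Num.real.
  by rewrite /b; case: ifP => // _; rewrite realV; apply/offdiagq_real/d_real.
have Uh : U^t* = dfun a + dfun b *m (N *m M).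
  by rewrite linearD /= map_mxD !trmx_mul !map_mxM !dfun_adj // Nh Mh.
have dfun0 f : (forall i, f (d 0 i) = 0) -> dfun f = 0.
  move=> f0; apply/matrixP => i j; rewrite !mxE f0; exact: mul0rn.
apply/unitarymxP; rewrite Uh mulmxDl !mulmxDr dfun_mul.
(* The cross terms vanish because [a] and [b] have disjoint supports. *)
rewrite mulmxA dfun_mul (dfun0 (fun t => a t * b t)) ?mul0mx ?addr0; last first.
  by move=> i; rewrite /a /b; case: (low (d 0 i)); rewrite ?mulr0 ?mul0r.
rewrite -mulmxA dfun_mul (dfun0 (fun t => b t * a t)) ?mulmx0 ?add0r; last first.
  by move=> i; rewrite /a /b; case: (low (d 0 i)); rewrite ?mulr0 ?mul0r.
rewrite mulmxA -[M *m N *m dfun b *m dfun b]mulmxA dfun_mul MN_dfun.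
have MNNM : M *m N *m (N *m M) = dfun (fun t => offdiagq t * offdiagq t).
  rewrite mulmxA -[M *m N *m N]mulmxA N2 flips_dfun // -mulmxA M2 dfun_mul.
  by apply: eq_dfun => i; rewrite offdiagq_flip.
rewrite -mulmxA MNNM dfun_mul dfun_add; apply/matrixP => i j; rewrite !mxE.
congr (_ *+ _); rewrite /a /b; case: ifP => [_|/norP[_ h]].
  by rewrite /= !mul0r addr0 mulr1.
by rewrite mul0r add0r -mulrA mulKf // mulVf.
Qed.

Lemma exists_intertwiner : exists2 W : 'M[C]_k, W \is unitarymx &
  W *m N = M *m W /\ forall f, W *m dfun f = dfun f *m W.
Proof.
exists U; first exact: intertwiner_unitary.
by split; [exact: intertwiner_offdiag | exact: intertwiner_dfun].
Qed.

End Intertwiner.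
End DiagonalPencil.

(** The intertwiner matches the off-diagonal parts and commutes with functions of d, so it carries
    P1 to Q1. The second projections follow, being half of [diag_mx d] minus the first. *)
Lemma unitary_conj_diag_pencil (C : numClosedFieldType) (k : nat) (d : 'rV[C]_k)
    (P1 P2 Q1 Q2 : 'M[C]_k) :
  P1^t* = P1 -> P1 *m P1 = P1 -> P2 *m P2 = P2 -> P1 + P2 *+ 2 = diag_mx d ->
  Q1^t* = Q1 -> Q1 *m Q1 = Q1 -> Q2 *m Q2 = Q2 -> Q1 + Q2 *+ 2 = diag_mx d ->
  (forall i, d 0 i \is Num.real) ->
  exists2 W : 'M[C]_k, W \is unitarymx & W *m P1 = Q1 *m W /\ W *m P2 = Q2 *m W.
Proof.
move=> P1h P1i P2i P12 Q1h Q1i Q2i Q12 dr.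
have [W Wu [WN Wd]] := exists_intertwiner
  (pencil_adj P1h dr) (pencil_adj Q1h dr)
  (pencil_flips P1i P2i P12) (pencil_flips Q1i Q2i Q12)
  (pencil_sqr P1i P2i P12) (pencil_sqr Q1i Q2i Q12)
  dr (spectrum_neq P1i P2i P12).
have W1 : W *m P1 = Q1 *m W.
  by rewrite -[P1](subrK (dfun d (@diagq C))) mulmxDr WN Wd -mulmxDl subrK.
exists W => //; split=> //.
have Ed : diag_mx d = dfun d id by congr diag_mx; apply/rowP=> i; rewrite mxE.
have e X Y : X + Y *+ 2 = diag_mx d -> Y = 2^-1 *: (dfun d id - X).
  rewrite -Ed => <-; rewrite addrC addKr -scaler_nat scalerA mulVf ?scale1r //.
  by rewrite pnatr_eq0.
by rewrite (e _ _ P12) (e _ _ Q12) -scalemxAr -scalemxAl mulmxBr mulmxBl Wd W1.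
Qed.

(** * Reduction to a common diagonal pencil *)

Lemma char_poly_conj (F : fieldType) (k : nat) (V A : 'M[F]_k) :
  V \in unitmx -> char_poly (V *m A *m invmx V) = char_poly A.
Proof.
move=> Vu; rewrite /char_poly.
have -> : char_poly_mx (V *m A *m invmx V) =
    map_mx polyC V *m char_poly_mx A *m map_mx polyC (invmx V).
  rewrite /char_poly_mx mulmxBr mulmxBl -!map_mxM; congr (_ - _).
  by rewrite mul_mx_scalar -scalemxAl -map_mxM mulmxV // map_mx1 scalemx1.
rewrite !det_mulmx mulrAC -det_mulmx -map_mxM mulmxV // map_mx1 det1.
exact: mul1r.
Qed.

Lemma codiagonalize_hermitian (C : numClosedFieldType) (k : nat) (A B : 'M[C]_k) :
  A^t* = A -> B^t* = B -> char_poly A = char_poly B ->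
  exists V W : 'M[C]_k, exists d : 'rV[C]_k,
    [/\ V \is unitarymx, W \is unitarymx, forall i, d 0 i \is Num.real,
        V *m A *m V^t* = diag_mx d & W *m B *m W^t* = diag_mx d].
Proof.
have spec (X : 'M[C]_k) : X^t* = X -> exists V : 'M[C]_k, exists d : 'rV[C]_k,
    [/\ V \is unitarymx, forall i, d 0 i \is Num.real,
     V *m X *m V^t* = diag_mx d
     & char_poly X = \prod_(x <- [tuple d 0 i | i < k]) ('X - x%:P)].
  move=> Xh; have Xs : X \is hermsymmx.
    by apply/is_hermitianmxP; rewrite expr0 scale1r Xh.
  have Vu := spectral_unitarymx X.
  have /orthomx_spectralP eX := hermitian_normalmx Xs.
  have eD : spectralmx X *m X *m (spectralmx X)^t* = diag_mx (spectral_diag X).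
    rewrite -invmx_unitary // {2}eX !mulmxA mulmxV ?unitarymx_unit // mul1mx.
    by rewrite mulmxK ?unitarymx_unit.
  exists (spectralmx X), (spectral_diag X); split=> //.
    by move=> i; apply: mxOverP; apply: hermitian_spectral_diag_real.
  rewrite -(char_poly_conj X (unitarymx_unit Vu)) invmx_unitary // eD.
  rewrite char_poly_trig ?diag_mx_is_trig // big_tuple; apply: eq_bigr => i _.
  by rewrite tnth_mktuple !mxE eqxx mulr1n.
move=> /spec[V [d [Vu dr VA Ad]]] /spec[W [e [Wu er WB Be]]] AB.
(* A split monic polynomial determines its roots with multiplicity, hence the two spectra up to
   order. *)
have /tuple_permP [s ds] : perm_eq [tuple d 0 i | i < k] [tuple e 0 i | i < k].
  by apply: prod_XsubC_eq; rewrite -Ad -Be.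
have de i : d 0 i = e 0 (s i).
  move/val_inj: ds => /(congr1 (fun t => tnth t i)).
  by rewrite !tnth_mktuple.
have Su : (perm_mx s : 'M[C]_k) \is unitarymx.
  by apply/unitarymxP; rewrite tr_perm_mx map_perm_mx -perm_mxM mulgV perm_mx1.
(* Permuting the eigenbasis of B lists its eigenvalues in the order of d. *)
exists V, (perm_mx s *m W), d; split=> //; first exact: mul_unitarymx.
rewrite trmx_mul map_mxM !mulmxA -[_ *m W *m B]mulmxA.
rewrite -[_ *m (W *m B) *m _]mulmxA WB.
rewrite tr_perm_mx map_perm_mx -row_permE -col_permE.
apply/matrixP=> i j; rewrite !mxE (inj_eq perm_inj) de; congr (_ *+ _).
Qed.

Lemma unitary_conj_of_char_poly (C : numClosedFieldType) (k : nat)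
    (P1 P2 Q1 Q2 : 'M[C]_k) :
  P1^t* = P1 -> P1 *m P1 = P1 -> P2^t* = P2 -> P2 *m P2 = P2 ->
  Q1^t* = Q1 -> Q1 *m Q1 = Q1 -> Q2^t* = Q2 -> Q2 *m Q2 = Q2 ->
  char_poly (P1 + P2 *+ 2) = char_poly (Q1 + Q2 *+ 2) ->
  exists2 W : 'M[C]_k, W \is unitarymx & W *m P1 = Q1 *m W /\ W *m P2 = Q2 *m W.
Proof.
have pencil_herm (X Y : 'M[C]_k) :
    X^t* = X -> Y^t* = Y -> (X + Y *+ 2)^t* = X + Y *+ 2.
  by move=> Xh Yh; rewrite !mulr2n !linearD /= !map_mxD Xh Yh.
move=> P1h P1i P2h P2i Q1h Q1i Q2h Q2i.
move/(codiagonalize_hermitian (pencil_herm _ _ P1h P2h) (pencil_herm _ _ Q1h Q2h)).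
move=> [V [W [d [Vu Wu dr Vd Wd]]]].
have cjD (X A B : 'M[C]_k) :
    X *m A *m X^t* + (X *m B *m X^t*) *+ 2 = X *m (A + B *+ 2) *m X^t*.
  by rewrite !mulr2n !mulmxDr !mulmxDl.
have cjh (X A : 'M[C]_k) : A^t* = A -> (X *m A *m X^t*)^t* = X *m A *m X^t*.
  by move=> Ah; rewrite !trmx_mul !map_mxM trmxCK Ah mulmxA.
have cji (X A : 'M[C]_k) : X \is unitarymx -> A *m A = A ->
    X *m A *m X^t* *m (X *m A *m X^t*) = X *m A *m X^t*.
  by move=> Xu Ai; rewrite !mulmxA mulmxKtV // -[X *m A *m A]mulmxA Ai.
have [U Uu [U1 U2]] := unitary_conj_diag_pencil
  (cjh V _ P1h) (cji _ _ Vu P1i) (cji _ _ Vu P2i) (etrans (cjD _ _ _) Vd)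
  (cjh W _ Q1h) (cji _ _ Wu Q1i) (cji _ _ Wu Q2i) (etrans (cjD _ _ _) Wd) dr.
(* Pass to the eigenbasis of the first pencil by V, apply the diagonal case, and return from that of
   the second by the adjoint of W. *)
exists (W^t* *m U *m V); first by rewrite !mul_unitarymx ?trmxC_unitary.
have back P Q : U *m (V *m P *m V^t*) = W *m Q *m W^t* *m U ->
    W^t* *m U *m V *m P = Q *m (W^t* *m U *m V).
  move=> /(congr1 (fun X => W^t* *m X *m V)).
  rewrite !mulmxA (mulmxKtV _ Vu) // -(invmx_unitary Wu).
  by rewrite mulVmx ?unitarymx_unit // mul1mx.
by split; exact: back.
Qed.

(** * Invariance and specialization of the characteristic polynomial of a tuple *)

Lemma Qpoly_unitarily_equivalent (R : realType) (n k : nat)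
    (A B : 'I_n -> 'M[R[i]]_k) :
  unitarily_equivalent A B -> Qpoly A = Qpoly B.
Proof.
case=> U Uu UAB; pose mC := map_mx (@mpolyC n.+1 R[i]).
have U_neq0 : \det (mC _ _ U) != 0.
  by rewrite det_map_mx mpolyC_eq0 -unitfE -unitmxE unitarymx_unit.
(* U times the pencil of A is the pencil of B times U; the determinant of U is a nonzero constant
   and cancels. *)
suff e : \det (mC _ _ U) * Qpoly A = \det (mC _ _ U) * Qpoly B.
  exact: mulfI U_neq0 _ _ e.
rewrite [RHS]mulrC -[LHS]det_mulmx -[RHS]det_mulmx.
apply: (congr1 determinant).
rewrite mulmxDr mulmxDl -scalemxAr -scalemxAl mulmx1 mul1mx; congr (_ + _).
rewrite mulmx_sumr mulmx_suml; apply: eq_bigr => i _.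
by rewrite -scalemxAr -scalemxAl -!map_mxM UAB.
Qed.

Lemma rmorph_Qpoly (R : realType) (n k : nat) (S : comNzRingType)
    (f : {rmorphism {mpoly R[i][n.+1]} -> S}) (A : 'I_n -> 'M[R[i]]_k) :
  f (Qpoly A) = \det ((f 'X_ord0)%:M +
    \sum_(i < n) f 'X_(lift ord0 i) *: map_mx (f \o @mpolyC n.+1 R[i]) (A i)).
Proof.
rewrite /Qpoly -det_map_mx; apply: (congr1 determinant).
rewrite map_mxD map_mxZ map_mx1 scalemx1 map_mx_sum; congr (_ + _).
by apply: eq_bigr => i _; rewrite map_mxZ map_mx_comp.
Qed.

(** Substituting z_0 = X, z_1 = -1, z_2 = -2 turns the pencil into X I - (p_1 + 2 p_2). *)
Lemma mmap_Qpoly_char_poly (R : realType) (k : nat) (p : 'I_2 -> 'M[R[i]]_k) :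
  mmap polyC (tnth [tuple 'X; -1; - 2]) (Qpoly p)
  = char_poly (p ord0 + p (lift ord0 ord0) *+ 2).
Proof.
set h := tnth _.
have fX i : mmap polyC h 'X_i = h i by rewrite mmapX mmap1U.
rewrite rmorph_Qpoly /= !fX big_ord_recl big_ord1 !fX.
apply: (congr1 determinant).
apply/matrixP => i j; rewrite !mxE /= !mmapC /h !(tnth_nth 0) /= !polyCD.
by ring.
Qed.

Theorem theorem3p4 (R : realType) (k : nat) (p q : 'I_2 -> 'M[R[i]]_k)
    (hp : forall j : 'I_2, is_projection (p j))
    (hq : forall j : 'I_2, is_projection (q j)) :
  unitarily_equivalent p q <-> Qpoly p = Qpoly q.
Proof.
split=> [|pq]; first exact: Qpoly_unitarily_equivalent.
have [p0h p0i] := hp ord0; have [p1h p1i] := hp (lift ord0 ord0).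
have [q0h q0i] := hq ord0; have [q1h q1i] := hq (lift ord0 ord0).
have e : char_poly (p ord0 + p (lift ord0 ord0) *+ 2) =
         char_poly (q ord0 + q (lift ord0 ord0) *+ 2).
  by rewrite -!mmap_Qpoly_char_poly pq.
have [W Wu [W0 W1]] :=
  unitary_conj_of_char_poly p0h p0i p1h p1i q0h q0i q1h q1i e.
exists W; first exact: Wu.
move=> i; case: (unliftP ord0 i) => [j|] ->; last exact: W0.
rewrite (ord1 j); exact: W1.
Qed.
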